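(* Every symmetric Boolean function on $n$ variables has a depth-three circuit of the form $\text{MOD}_5 \circ \text{MOD}_6 \circ \text{MOD}_5$ of size $\exp(O(n^{1/3}\log n))$. Furthermore, the circuit can be chosen so that on every input, the sum of the inputs to the output gate is always congruent to either $0$ or $1$ modulo $5$.
   Context: A Boolean function is symmetric if its value depends only on the number of ones in the input. A $\text{MOD}_m$ gate has unbounded fan-in and outputs $1$ iff the sum of its Boolean inputs (counted with wire multiplicity) is divisible by $m$. $G_1\circ G_2\circ G_3$ denotes a depth-3 circuit with output gate of type $G_1$, middle layer of gates of type $G_2$, and bottom layer (adjacent to the inputs) of gates of type $G_3$. Size is the number of gates. *)

(* Defs.v *)
From mathcomp Require Import all_boot all_order all_algebra.
From mathcomp Require Import all_classical all_reals all_analysis.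
Set Implicit Arguments.
Unset Strict Implicit.
Unset Printing Implicit Defensive.

Local Open Scope nat_scope.

Definition num_ones n (x : {ffun 'I_n -> bool}) : nat := \sum_(i < n) x i.

Definition symmetric_fun n (f : {ffun 'I_n -> bool} -> bool) : Prop :=
  forall x y, num_ones x = num_ones y -> f x = f y.

(* [w i] is the number of parallel wires from the [i]-th potential input;
   [w i = 0] means that this input is not connected to the gate. *)
Definition wire_sum k (w : 'I_k -> nat) (x : 'I_k -> bool) : nat :=
  \sum_(i < k) w i * x i.

Definition mod_gate m k (w : 'I_k -> nat) (x : 'I_k -> bool) : bool :=
  m %| wire_sum w x.

(* MOD_m1 o MOD_m2 o MOD_m3 circuits on [n] variables: [m1] is the modulus of
   the output gate and [m3] that of the gates reading the variables.  Wires only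
   join consecutive layers; neither constants nor negated variables are provided
   as inputs. *)
Record mod_circuit3 (m1 m2 m3 n : nat) := ModCircuit3 {
  bot_gates : nat;
  mid_gates : nat;
  bot_wires : 'I_bot_gates -> 'I_n -> nat;
  mid_wires : 'I_mid_gates -> 'I_bot_gates -> nat;
  out_wires : 'I_mid_gates -> nat
}.

Section Semantics.
Variables (m1 m2 m3 n : nat) (C : mod_circuit3 m1 m2 m3 n).

Definition bot_val (x : {ffun 'I_n -> bool}) (j : 'I_(bot_gates C)) : bool :=
  mod_gate m3 (bot_wires j) x.

Definition mid_val (x : {ffun 'I_n -> bool}) (k : 'I_(mid_gates C)) : bool :=
  mod_gate m2 (mid_wires k) (bot_val x).

Definition out_sum (x : {ffun 'I_n -> bool}) : nat :=
  wire_sum (@out_wires _ _ _ _ C) (mid_val x).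

Definition circuit_val (x : {ffun 'I_n -> bool}) : bool :=
  mod_gate m1 (@out_wires _ _ _ _ C) (mid_val x).

Definition circuit_size : nat := (bot_gates C + mid_gates C).+1.

End Semantics.

(* Main.v *)
Require Import Defs.
From mathcomp Require Import all_boot all_order all_algebra.
From mathcomp Require Import all_classical all_reals all_analysis.
From mathcomp Require Import zify ring lra.
Set Implicit Arguments.
Unset Strict Implicit.
Unset Printing Implicit Defensive.
Import Order.TTheory GRing.Theory Num.Theory.
Local Open Scope ring_scope.

(* A symmetric function depends only on the number z of zeros of its input, and by
   the Chinese remainder theorem [z = t] is the conjunction of the congruences z = t
   modulo 2^a, 3^b and 5^c as soon as 2^a 3^b 5^c > n; each factor can be taken of
   order n^(1/3).  A function of z with period p^k is, modulo p, a combination of the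
   C(z, j) with j < p^k (Newton interpolation), and C(z, j) is the sum of the NORs of
   all j-subsets of the variables.  Summing [m | A + c.y] over all c in (Z/m)^r gives
   m^r [m | A] if the bits y vanish and m^(r-1) otherwise.  As 5 = -1 mod 6, this with
   m = 5 writes NORs of few variables modulo 6 as combinations of MOD_5 gates, so one
   MOD_6 gate tests z = t modulo 2^a and 3^b.  As 6 = 1 mod 5, the same identity with
   m = 6 writes the product of such a test with a NOR modulo 5 as a combination of
   MOD_6 gates; the NORs account for the test modulo 5^c, and the output gate sums
   over the t at which the function is false. *)

(** * Newton interpolation and periodicity of binomials modulo a prime *)

Section Newton.
Variable V : zmodType.

(** The system is triangular with unit diagonal, as ['C(N, N) = 1] and ['C(z, N) = 0] for [z < N]:
    it is solved without division, and the coefficients stay killed by [p]. *)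
Lemma newton_interpolation (p : nat) (g : nat -> V) (N : nat) :
    (forall z, g z *+ p = 0) ->
  exists c : nat -> V, (forall j, c j *+ p = 0) /\
    forall z, (z < N)%N -> \sum_(j < N) c j *+ 'C(z, j) = g z.
Proof.
move=> gp; elim: N => [|N [c [cp cE]]].
  by exists (fun=> 0); split=> // j; rewrite mul0rn.
pose a := g N - \sum_(j < N) c j *+ 'C(N, j).
exists (fun j => if (j < N)%N then c j else a); split.
  move=> j; case: ifP => // _; rewrite /a mulrnBl gp -sumrMnl big1 ?subr0 //.
  by move=> i _; rewrite mulrnAC cp mul0rn.
move=> z; rewrite ltnS leq_eqVlt big_ord_recr /= ltnn => zN.
under eq_bigr => i _ do rewrite ltn_ord.
case/predU1P: zN => [->|zN]; first by rewrite binn mulr1n /a addrC subrK.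
by rewrite bin_small // mulr0n addr0 cE.
Qed.

Lemma mulrn_mod (v : V) (p a : nat) : v *+ p = 0 -> v *+ (a %% p) = v *+ a.
Proof.
by move=> vp; rewrite [in RHS](divn_eq a p) mulrnDr mulnC mulrnA vp mul0rn add0r.
Qed.

(** [i * 'C(p ^ k, i)] is a multiple of [p ^ k]; were the binomial prime to [p], [p ^ k] would
    divide [i]. *)
Lemma prime_dvd_bin_exp (p k i : nat) :
  prime p -> (0 < i < p ^ k)%N -> (p %| 'C(p ^ k, i))%N.
Proof.
move=> pp /andP[i0 iN]; apply: contraLR iN => npC; rewrite -leqNgt.
apply: dvdn_leq => //; rewrite -(@Gauss_dvdl _ _ 'C(p ^ k, i)); last first.
  by rewrite coprimeXl // prime_coprime.
case: i i0 npC => // i _ _; rewrite -mul_bin_diag.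
exact: dvdn_mulr.
Qed.

Lemma bin_add_prime_exp (p k z j : nat) : prime p -> (j < p ^ k)%N ->
  ('C(z + p ^ k, j) = 'C(z, j) %[mod p])%N.
Proof.
move=> pp jN; rewrite addnC -binomial.Vandermonde big_ord_recl /= bin0 mul1n subn0.
rewrite -modnDmr [X in (_ + X)%N](_ : _ = 0)%N ?addn0 //; apply/eqP.
apply: dvdn_sum => i _; apply/dvdn_mulr/prime_dvd_bin_exp => //=.
by rewrite (leq_ltn_trans _ jN) // /bump /=; have := ltn_ord i; lia.
Qed.

Lemma newton_periodic (p k : nat) (g : nat -> V) :
    prime p -> (forall z, g z *+ p = 0) ->
  exists c : nat -> V,
    forall z, \sum_(j < p ^ k) c j *+ 'C(z, j) = g (z %% p ^ k)%N.
Proof.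
move=> pp gp; have [c [cp cE]] := @newton_interpolation p g (p ^ k) gp.
exists c => z; have N0 : (0 < p ^ k)%N by rewrite expn_gt0 prime_gt0.
rewrite -(cE (z %% p ^ k)%N) ?ltn_mod //; apply: eq_bigr => j _.
rewrite -(@mulrn_mod _ p 'C(z, j)) // -(@mulrn_mod _ p 'C(_ %% _, j)) //.
congr (_ *+ _); rewrite [in LHS](divn_eq z (p ^ k)) addnC.
elim: (z %/ p ^ k)%N => [|q IH]; first by rewrite mul0n addn0.
by rewrite mulSn addnCA addnC bin_add_prime_exp.
Qed.

End Newton.

(** * Linear combinations of gates *)

Section Spans.
Variables (R : comNzRingType) (X : Type) (I : finType) (gate : I -> X -> bool).

Definition spanned (F : X -> R) : Prop :=
  exists a : I -> R, forall x, F x = \sum_i a i *+ gate i x.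

Lemma spanned_ext (F G : X -> R) : F =1 G -> spanned F -> spanned G.
Proof. by move=> FG [a aE]; exists a => x; rewrite -FG. Qed.

Lemma spanned_gate (i : I) : spanned (fun x => (gate i x)%:R).
Proof.
exists (fun j => (j == i)%:R) => x; rewrite (bigD1 i) //= eqxx big1 ?addr0 //.
by move=> j /negPf->; rewrite mul0rn.
Qed.

Lemma spannedD (F G : X -> R) :
  spanned F -> spanned G -> spanned (fun x => F x + G x).
Proof.
move=> [a aE] [b bE]; exists (fun i => a i + b i) => x.
by rewrite aE bE -big_split /=; apply: eq_bigr => i _; rewrite mulrnDl.
Qed.

Lemma spannedZ (r : R) (F : X -> R) : spanned F -> spanned (fun x => r * F x).
Proof.
move=> [a aE]; exists (fun i => r * a i) => x.
by rewrite aE mulr_sumr; apply: eq_bigr => i _; rewrite mulrnAr.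
Qed.

Lemma spannedB (F G : X -> R) :
  spanned F -> spanned G -> spanned (fun x => F x - G x).
Proof.
move=> hF hG; apply: (spanned_ext _ (spannedD hF (spannedZ (-1) hG))) => x.
by rewrite mulN1r.
Qed.

Lemma spanned_sum (J : Type) (r : seq J) (P : pred J) (F : J -> X -> R) :
  (forall j, P j -> spanned (F j)) -> spanned (fun x => \sum_(j <- r | P j) F j x).
Proof.
move=> hF; elim: r => [|j r IH].
  exists (fun=> 0) => x; rewrite big_nil big1 // => i _; exact: mul0rn.
case Pj: (P j); last by apply: (spanned_ext _ IH) => x; rewrite big_cons Pj.
by apply: (spanned_ext _ (spannedD (hF j Pj) IH)) => x; rewrite big_cons Pj.
Qed.

End Spans.

(** * NORs, linear forms and sums over shifts *)

Section Forms.
Variable n : nat.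
Notation input := {ffun 'I_n -> bool}.

Definition nor (s : seq 'I_n) (x : input) : bool := all (fun i => ~~ x i) s.

Definition zeros (x : input) : nat := #|[set i | ~~ x i]|.

Lemma bin_zeros (x : input) (j : nat) :
  'C(zeros x, j) = (\sum_(S : {set 'I_n} | #|S| == j) nor (enum S) x)%N.
Proof.
rewrite /zeros -cards_draws -sum1_card big_mkcond [RHS]big_mkcond /=.
apply: eq_bigr => S _; rewrite !inE andbC; case: eqP => //= _.
suff -> : nor (enum S) x = (S \subset [set i | ~~ x i]) by case: (_ \subset _).
apply/allP/fintype.subsetP => h i.
  by rewrite inE => iS; apply: h; rewrite mem_enum.
by rewrite mem_enum => /h; rewrite inE.
Qed.

(** The factor [h] is 1 in the bottom layer and a test modulo 2- and 3-powers in the middle one;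
    [N <= d.+1] keeps the subsets to at most [d] variables. *)
Lemma spanned_bin_zeros (R : comNzRingType) (I : finType) (gate : I -> input -> bool)
    (h : input -> R) (d N : nat) (c : nat -> R) :
    (N <= d.+1)%N ->
    (forall s, (size s <= d)%N -> spanned gate (fun x => h x * (nor s x)%:R)) ->
  spanned gate (fun x => h x * \sum_(j < N) c j *+ 'C(zeros x, j)).
Proof.
move=> Nd hs; pose G j (S : {set 'I_n}) x := c j * (h x * (nor (enum S) x)%:R).
have := @spanned_sum R _ I gate 'I_N (index_enum _) predT
  (fun j x => \sum_(S : {set 'I_n} | #|S| == j) G j S x); case.
  move=> j _; apply: spanned_sum => S /eqP Sj; apply/spannedZ/hs.
  by rewrite -cardE Sj -ltnS (leq_trans (ltn_ord j)).
move=> a aE; exists a => x; rewrite -aE mulr_sumr; apply: eq_bigr => j _.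
rewrite bin_zeros -mulr_natr natr_sum !mulr_sumr; apply: eq_bigr => S _.
by rewrite /G; ring.
Qed.

Section Modulus.
Variable m : nat.

(** [None] is padding: it turns forms with at most [d] terms into [d]-tuples, a finite type that can
    index gates. *)
Notation wire := (option ('I_n * 'Z_m)).

Definition lin (l : seq wire) (x : input) : 'Z_m :=
  \sum_(o <- l) (if o is Some p then p.2 *+ x p.1 else 0).

Definition wire_weight (l : seq wire) (i : 'I_n) : 'Z_m :=
  \sum_(o <- l) (if o is Some p then (if p.1 == i then p.2 else 0) else 0).

Lemma linE (l : seq wire) (x : input) : lin l x = \sum_i wire_weight l i *+ x i.
Proof.
under eq_bigr => i _ do rewrite /wire_weight -sumrMnl.
rewrite exchange_big /=; apply: eq_bigr => -[[i c]|] _ /=.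
  rewrite (bigD1 i) //= eqxx big1 ?addr0 // => j.
  by rewrite eq_sym => /negPf->; rewrite mul0rn.
by rewrite big1 // => i _; rewrite mul0rn.
Qed.

Lemma lin_cons (i : 'I_n) (c : 'Z_m) (l : seq wire) (x : input) :
  lin (Some (i, c) :: l) x = c *+ x i + lin l x.
Proof. by rewrite /lin big_cons. Qed.

Lemma lin_pad (l : seq wire) (k : nat) (x : input) : lin (l ++ nseq k None) x = lin l x.
Proof. by rewrite /lin big_cat /= [X in _ + X]big_nseq /= iter_addr_0 mul0rn addr0. Qed.

Variable A : input -> 'Z_m.

(* [shift_count s l x] counts the coefficient vectors [c] on the variables of [s]
   for which [A x + lin l x + c . x] vanishes. *)
Fixpoint shift_count (s : seq 'I_n) (l : seq wire) (x : input) : nat :=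
  if s is i :: s' then \sum_(c : 'Z_m) shift_count s' (Some (i, c) :: l) x
  else (A x + lin l x == 0)%R.

(** The coefficient of a variable at 0 is irrelevant and gives a factor [m]; that of a variable at 1
    runs through all residues, exactly one of which cancels the rest. *)
Lemma shift_countE (s : seq 'I_n) (l : seq wire) (x : input) : (1 < m)%N ->
  shift_count s l x =
    (if nor s x then m ^ size s * (A x + lin l x == 0)%R else m ^ (size s).-1)%N.
Proof.
move=> m1; have cZ : #|'Z_m| = m by rewrite card_ord Zp_cast.
elim: s l => [|i s IH] l /=; first by rewrite mul1n.
under eq_bigr => c _ do rewrite IH lin_cons.
case: (x i) => /=.
  case: (boolP (nor s x)) => [_|ns].
    rewrite -big_distrr /= (bigD1 (- (A x + lin l x))) //= big1 => [|c].
      by rewrite mulr1n addrCA addNr eqxx addn0 muln1.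
    by rewrite mulr1n addrCA addr_eq0 => /negPf->.
  (* The empty NOR is true, so [s] is nonempty and the predecessor is not truncated. *)
  rewrite sum_nat_const cZ -expnS prednK //.
  by rewrite lt0n size_eq0; apply: contra ns => /eqP->.
under eq_bigr => c _ do rewrite mulr0n add0r.
rewrite sum_nat_const cZ; case: (boolP (nor s x)) => [_|ns]; first by rewrite mulnA expnS.
rewrite -expnS prednK // lt0n size_eq0; by apply: contra ns => /eqP->.
Qed.

Lemma spanned_shift_count (R : comNzRingType) (I : finType)
    (gate : I -> input -> bool) (d : nat) :
    (forall l, (size l <= d)%N ->
      spanned gate (fun x => (A x + lin l x == 0)%R%:R : R)) ->
  forall s l, (size s + size l <= d)%N ->
    spanned gate (fun x => (shift_count s l x)%:R : R).
Proof.
move=> hA; elim=> [|i s IH] l /= sl; first exact: hA.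
have := @spanned_sum R _ I gate 'Z_m (index_enum _) predT
  (fun c x => (shift_count s (Some (i, c) :: l) x)%:R).
case=> [c _|a aE]; first by apply: IH; rewrite /= addnS.
by exists a => x; rewrite natr_sum aE.
Qed.

End Modulus.
End Forms.

(** * Circuits from coefficients in Z/5 and Z/6 *)

Lemma mod_gate_Zp (m k : nat) (w : 'I_k -> 'Z_m) (y : 'I_k -> bool) : (1 < m)%N ->
  mod_gate m (fun i => w i : nat) y = (\sum_i w i *+ y i == 0).
Proof.
move=> m1; rewrite /mod_gate.
have -> : \sum_i w i *+ y i = (wire_sum (fun i => w i : nat) y)%:R.
  rewrite natr_sum; apply: eq_bigr => i _.
  by rewrite natrM natr_Zp mulr_natr.
by rewrite -val_eqE /= val_Zp_nat.
Qed.

Lemma circuit_of_layers (n : nat) (B M : finType) (bw : B -> 'I_n -> 'Z_5)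
    (mw : M -> B -> 'Z_6) (ow : M -> 'Z_5) :
  exists C : mod_circuit3 5 6 5 n,
    circuit_size C = (#|B| + #|M|).+1 /\
    forall x, (out_sum C x)%:R =
      \sum_k ow k *+ (\sum_b mw k b *+ (\sum_i bw b i *+ x i == 0) == 0) :> 'Z_5.
Proof.
exists (@ModCircuit3 5 6 5 n #|B| #|M| (fun j i => bw (enum_val j) i)
  (fun k j => mw (enum_val k) (enum_val j)) (fun k => ow (enum_val k))).
split=> // x; rewrite natr_sum [RHS]big_enum_val; apply: eq_bigr => k _.
rewrite natrM natr_Zp mulr_natr; congr (_ *+ nat_of_bool _).
rewrite /mid_val mod_gate_Zp // [in RHS]big_enum_val; congr (_ == 0).
by apply: eq_bigr => j _; rewrite /bot_val mod_gate_Zp.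
Qed.

(** * NORs and tests as combinations of MOD gates *)

Section Layers.
Variables n d : nat.
Notation input := {ffun 'I_n -> bool}.

Definition lin_gate (m : nat) (A : input -> 'Z_m)
  (t : d.-tuple (option ('I_n * 'Z_m))) (x : input) : bool := A x + lin t x == 0.

Lemma spanned_shift (R : comNzRingType) (m : nat) (I : finType)
    (gate : I -> input -> bool) (A : input -> 'Z_m) :
    (forall t, spanned gate (fun x => (lin_gate A t x)%:R : R)) ->
  forall s l, (size s + size l <= d)%N ->
    spanned gate (fun x => (shift_count A s l x)%:R : R).
Proof.
move=> hA; apply: spanned_shift_count => l ld.
have sz : size (l ++ nseq (d - size l) None) == d.
  by rewrite size_cat size_nseq subnKC.
apply: spanned_ext (hA (Tuple sz)) => x.
by rewrite /lin_gate /= lin_pad.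
Qed.

Notation bottom_gate := (@lin_gate 5 (fun=> 0)).

(* With T the sum of [i + c.s = 0] over all [c], modulo 6 the shift identity reads
   [T = (-1)^|s| (NOR(i :: s) + NOR(s) - 1)]. *)
Lemma spanned_nor_bottom (s : seq 'I_n) : (size s <= d)%N ->
  spanned bottom_gate (fun x => (nor s x)%:R : 'Z_6).
Proof.
have hT := @spanned_shift 'Z_6 5 _ _ _ (spanned_gate 'Z_6 bottom_gate).
elim: s => [|i s IH] /= sd.
  by apply: spanned_ext (hT [::] [::] isT) => x; rewrite /= /lin big_nil addr0 eqxx.
have hs := IH (ltnW sd).
(* The constant 1 is a gate with the zero form, which always fires. *)
have h1 := hT [::] [::] isT.
have := hT s [:: Some (i, 1)]; rewrite addn1 => /(_ sd) h.
apply: spanned_ext (spannedD (spannedZ ((-1) ^+ size s) h) (spannedB h1 hs)) => x /=.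
have z5 (y : 'Z_5) : 0 + y = y by exact: add0r.
rewrite shift_countE //= !z5 lin_cons /lin big_nil !addr0 eqxx.
have E5 : 5%:R = -1 :> 'Z_6 by apply/val_inj.
case: (boolP (nor s x)) => ns.
  rewrite natrM natrX E5 mulrA -expr2 sqrr_sign andbT subrr addr0.
  by rewrite mul1r; case: (x i).
rewrite andbF natrX E5 subr0.
have : (0 < size s)%N by rewrite lt0n size_eq0; apply: contra ns => /eqP->.
case: (size s) => // k _ /=; rewrite exprS mulrAC -mulrA -expr2 sqrr_sign mulr1.
by rewrite addNr.
Qed.

(** A variable is the empty NOR minus its own NOR; middle gates can thus test forms in the variables
    although they read only bottom gates. *)
Lemma spanned_lin_bottom (t : seq (option ('I_n * 'Z_6))) : (0 < d)%N ->
  spanned bottom_gate (lin t).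
Proof.
move=> d0; apply: spanned_sum => -[[i c]|] _ /=; last first.
  by exists (fun=> 0) => x; rewrite big1 // => j _; rewrite mul0rn.
have h0 := @spanned_nor_bottom [::] isT.
have h1 := @spanned_nor_bottom [:: i] d0.
apply: spanned_ext (spannedZ c (spannedB h0 h1)) => x.
by rewrite /= andbT; case: (x i); rewrite /= ?subr0 ?subrr ?mulr1 ?mulr0.
Qed.

Variables (J : finType) (A : J -> input -> 'Z_6).

Definition middle_form (o : option J) (x : input) : 'Z_6 :=
  if o is Some j then A j x else 1.

Definition middle_gate (k : option J * d.-tuple (option ('I_n * 'Z_6))) :=
  lin_gate (middle_form k.1) k.2.

(* Modulo 5, the sum over shifts of a form [F] is [F = 0] where the NOR holds and 1
   elsewhere; subtracting the same sum for [F = 1] leaves the product. *)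
Lemma spanned_middle (j : J) (s : seq 'I_n) : (size s <= d)%N ->
  spanned middle_gate (fun x => (A j x == 0)%R%:R * (nor s x)%:R : 'Z_5).
Proof.
move=> sd.
have hT o : spanned middle_gate (fun x => (shift_count (middle_form o) s [::] x)%:R : 'Z_5).
  apply: spanned_shift; last by rewrite addn0.
  move=> t; exact: (spanned_gate 'Z_5 middle_gate (o, t)).
apply: spanned_ext (spannedB (hT (Some j)) (hT None)) => x.
have E6 : 6%:R = 1 :> 'Z_5 by apply/val_inj.
rewrite !shift_countE //= /lin big_nil !addr0 oner_eq0 muln0.
case: (nor s x); last by rewrite subrr mulr0.
by rewrite natrM natrX E6 expr1n mul1r subr0 mulr1.
Qed.

End Layers.

(** * The circuit of a symmetric function *)

Lemma eq_of_mod235 (k2 k3 k5 y z : nat) :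
    (y < 2 ^ k2 * 3 ^ k3 * 5 ^ k5)%N -> (z < 2 ^ k2 * 3 ^ k3 * 5 ^ k5)%N ->
  (y == z) = [&& y == z %[mod 2 ^ k2], y == z %[mod 3 ^ k3] & y == z %[mod 5 ^ k5]]%N.
Proof.
move=> yN zN; have c23 : coprime (2 ^ k2) (3 ^ k3) by rewrite coprimeXl // coprimeXr.
have c235 : coprime (2 ^ k2 * 3 ^ k3) (5 ^ k5).
  by rewrite coprimeXr // coprimeMl !coprimeXl.
rewrite andbA -(chinese_remainder c23) -(chinese_remainder c235).
by rewrite !modn_small.
Qed.

Lemma mul_bool_eq0 (V : zmodType) (v : V) (b : bool) (p : nat) :
  v *+ p = 0 -> v *+ b *+ p = 0.
Proof. by case: b; rewrite ?mul0rn. Qed.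

(** All [d]-tuples are taken as gates, whence the powers; [n.+2] counts the forms [A t] for [t <= n]
    and the constant 1. The sum is the negation of [f] because a MOD gate fires on 0. *)
Lemma symmetric_circuit (n : nat) (f : {ffun 'I_n -> bool} -> bool) (d k2 k3 k5 : nat) :
    symmetric_fun f -> (2 ^ k2 <= d)%N -> (3 ^ k3 <= d)%N -> (5 ^ k5 <= d)%N ->
    (n < 2 ^ k2 * 3 ^ k3 * 5 ^ k5)%N ->
  exists C : mod_circuit3 5 6 5 n,
    circuit_size C = ((5 * n).+1 ^ d + n.+2 * (6 * n).+1 ^ d).+1 /\
    forall x, (out_sum C x)%:R = (~~ f x)%:R :> 'Z_5.
Proof.
move=> fS d2 d3 d5 nN; have d0 : (0 < d)%N by apply: leq_trans d2; rewrite expn_gt0.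
have zn (x : {ffun 'I_n -> bool}) : (zeros x < n.+1)%N.
  by rewrite ltnS -[X in (_ <= X)%N](card_ord n) max_card.
pose g (t : nat) := [exists x, (zeros x == t) && f x].
have fg x : f x = g (zeros x).
  apply/idP/existsP => [fx|[y /andP[/eqP yx fy]]]; first by exists x; rewrite eqxx.
  rewrite (fS x y) //; have zE (u : {ffun 'I_n -> bool}) : (zeros u + num_ones u = n)%N.
    rewrite /zeros /num_ones -sum1_card big_mkcond -big_split /=.
    under eq_bigr => i _ do rewrite inE.
    by rewrite (eq_bigr (fun=> 1%N)) ?sum1_card ?card_ord // => i _; case: (u i).
  by apply/eqP; rewrite -(eqn_add2l (zeros y)) {1}yx !zE.
(* In Z/6 the multiples of 3 carry the test modulo [2 ^ k2], those of 2 the test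
   modulo [3 ^ k3], and a sum of the two vanishes only if both do. *)
have exA (t : 'I_n.+1) : exists At : {ffun 'I_n -> bool} -> 'Z_6,
    spanned (@lin_gate n d 5 (fun=> 0)) At /\
    forall x, (At x == 0) =
      (zeros x == t %[mod 2 ^ k2])%N && (zeros x == t %[mod 3 ^ k3])%N.
  have h2 : 3%:R *+ 2 = 0 :> 'Z_6 by apply/val_inj.
  have h3 : 2%:R *+ 3 = 0 :> 'Z_6 by apply/val_inj.
  have [c2 c2E] := @newton_periodic 'Z_6 2 k2
    (fun z => 3%:R *+ (z != t %% 2 ^ k2)%N) isT
    (fun z => mul_bool_eq0 _ h2).
  have [c3 c3E] := @newton_periodic 'Z_6 3 k3
    (fun z => 2%:R *+ (z != t %% 3 ^ k3)%N) isT
    (fun z => mul_bool_eq0 _ h3).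
  exists (fun x => 1 * (\sum_(j < 2 ^ k2) c2 j *+ 'C(zeros x, j))
               + 1 * (\sum_(j < 3 ^ k3) c3 j *+ 'C(zeros x, j))); split.
    by apply: spannedD; apply: (@spanned_bin_zeros _ _ _ _ (fun=> 1) d) => [|s sd];
      rewrite ?(leq_trans _ (leqnSn d)) //;
      apply: spanned_ext (spanned_nor_bottom sd) => x; rewrite mul1r.
  move=> x; rewrite c2E c3E !mul1r.
  by case: (_ == _ %[mod 2 ^ k2])%N; case: (_ == _ %[mod 3 ^ k3])%N.
have [A AE] := fin_all_exists exA.
have [ow owE] : spanned (middle_gate (d := d) A) (fun x => (~~ f x)%:R : 'Z_5).
  pose h t x := (A t x == 0)%R%:R : 'Z_5.
  have hs (t : 'I_n.+1) : ~~ g t -> spanned (middle_gate (d := d) A)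
      (fun x => (zeros x == t)%:R : 'Z_5).
    have h5 : 1 *+ 5 = 0 :> 'Z_5 by apply/val_inj.
    (* Interpolation supplies the test modulo [5 ^ k5], and the factor [h t] the other two
       congruences. *)
    move=> _; have [c cE] := @newton_periodic 'Z_5 5 k5
      (fun z => (z == t %% 5 ^ k5)%N%:R) isT (fun z => mul_bool_eq0 _ h5).
    apply: spanned_ext (@spanned_bin_zeros n 'Z_5 _ _ (h t) d (5 ^ k5) c _ _).
    - move=> x; rewrite cE /h (AE t).2 -natrM mulnb; congr (nat_of_bool _)%:R.
      by rewrite -andbA -eq_of_mod235 //; apply: leq_ltn_trans nN; rewrite -ltnS.
    - exact: leqW.
    - by move=> s; apply: spanned_middle.
  (* Exactly one [t <= n] equals [zeros x], so at most one summand is nonzero. *)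
  apply: spanned_ext (spanned_sum (index_enum _) hs) => x; rewrite fg.
  have [gx|gx] := boolP (g (zeros x)).
    rewrite big1 // => t gt; case: eqP => // zt.
    by rewrite -zt gx in gt.
  rewrite (bigD1 (Ordinal (zn x))) //= eqxx big1 ?addr0 // => t /andP[_ tx].
  by case: eqP => // zt; rewrite -val_eqE /= zt eqxx in tx.
pose bw (b : d.-tuple (option ('I_n * 'Z_5))) := wire_weight b.
have exmw (k : option 'I_n.+1 * d.-tuple (option ('I_n * 'Z_6))) :
    spanned (@lin_gate n d 5 (fun=> 0)) (fun x => middle_form A k.1 x + lin k.2 x).
  apply: spannedD; last exact: spanned_lin_bottom.
  case: k.1 => [t|]; first exact: (AE t).1.
  by apply: spanned_ext (@spanned_nor_bottom n d [::] isT) => x.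
have [mw mwE] := fin_all_exists exmw.
have [C [CS CE]] := circuit_of_layers bw mw ow.
exists C; split.
  rewrite CS !card_prod !card_tuple !card_option !card_prod !card_ord /=.
  by rewrite [(n * 5)%N]mulnC [(n * 6)%N]mulnC.
move=> x; rewrite CE owE; apply: eq_bigr => k _.
rewrite /middle_gate /lin_gate mwE; congr (_ *+ nat_of_bool (_ == _)).
apply: eq_bigr => b _; rewrite /lin_gate /bw -linE.
by rewrite (add0r (lin b x : 'Z_5)).
Qed.

(** * Size estimates and conclusion *)

(** The least such [k] works: by minimality the cube of the previous power is at most [n]. *)
Lemma prime_power_cube (p n : nat) : (1 < p)%N ->
  exists2 k, (n < (p ^ k) ^ 3)%N & (0 < n)%N -> ((p ^ k) ^ 3 <= p ^ 3 * n)%N.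
Proof.
move=> p1; have ex : exists k, (n < (p ^ k) ^ 3)%N.
  exists n; apply: leq_trans (ltn_expl n p1) _.
  by rewrite -[X in (X <= _)%N]expn1 leq_pexp2l // expn_gt0 ltnW.
case: (ex_minnP ex) => -[|k] nk kmin.
  exists 0%N => // n_gt0; move: nk.
  by rewrite !expn0 exp1n ltnS leqn0; case: n n_gt0 {ex kmin}.
exists k.+1 => //.
move=> _; rewrite (expnS p) expnMn leq_mul2l; apply/orP; right.
by rewrite leqNgt; apply/negP => /kmin; rewrite ltnn.
Qed.

Lemma size_bound (R : realType) (n d : nat) : (2 <= n)%N -> (d ^ 3 <= 125 * n)%N ->
  ((5 * n).+1 ^ d + n.+2 * (6 * n).+1 ^ d).+1%:R <=
    expR (23 * (n%:R `^ (1 / 3) * ln n%:R)) :> R.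
Proof.
move=> n2 dn; have n0 : (0 : R) < n%:R by rewrite ltr0n; lia.
(* Both bases are at most [7 * n <= n ^ 4], and the remaining factor [n + 4] is at most [n ^ 3]. *)
have sz : (((5 * n).+1 ^ d + n.+2 * (6 * n).+1 ^ d).+1 <= n ^ (4 * d + 3))%N.
  have n3 : (8 <= n ^ 3)%N by rewrite (@leq_exp2r 2 n 3).
  have n7 : (7 * n <= n ^ 4)%N by rewrite expnSr leq_mul2r; lia.
  have le_pow a : (a <= n ^ 4)%N -> (a ^ d <= n ^ (4 * d))%N.
    by rewrite expnM; case: (d) => // k; rewrite leq_exp2r.
  have h5 : ((5 * n).+1 ^ d <= n ^ (4 * d))%N by apply: le_pow; lia.
  have h6 : ((6 * n).+1 ^ d <= n ^ (4 * d))%N by apply: le_pow; lia.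
  have h1 : (0 < n ^ (4 * d))%N by rewrite expn_gt0; lia.
  have n4 : (n + 4 <= n ^ 3)%N by rewrite !expnS expn0; nia.
  by rewrite expnD; move: (n ^ 3)%N n4 => N n4 in n3 n7 *; nia.
apply: le_trans (_ : (n ^ (4 * d + 3))%:R <= _); first by rewrite ler_nat.
rewrite natrX -[X in X ^+ _](lnK n0) -expRM_natl ler_expR mulrA -mulr_natl.
have ln0 : 0 <= ln (n%:R : R) by rewrite ln_ge0 // ler1n; lia.
rewrite ler_wpM2r //.
have r0 : 0 <= n%:R `^ (1 / 3) :> R by exact: powR_ge0.
have r3 : (n%:R `^ (1 / 3)) ^+ 3 = n%:R :> R.
  by rewrite -powR_mulrn // -powRrM divfK // powRr1 // ltW.
have r1 : 1 <= n%:R `^ (1 / 3) :> R.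
  by rewrite -(@ler_pXn2r _ 3) ?nnegrE // r3 expr1n ler1n; lia.
have d3 : d%:R <= 5 * n%:R `^ (1 / 3) :> R.
  rewrite -(@ler_pXn2r _ 3) ?nnegrE ?mulr_ge0 // exprMn r3 -!natrX -natrM ler_nat.
  exact: dn.
(* The constant 23 is [4 * 5 + 3], since the cube root of [n] is at least 1. *)
by rewrite natrD natrM; lra.
Qed.

Theorem theorem3p1 (R : realType) :
  exists2 c : R, 0 < c &
    forall (n : nat) (f : {ffun 'I_n -> bool} -> bool), symmetric_fun f ->
      exists C : mod_circuit3 5 6 5 n,
        [/\ forall x, circuit_val C x = f x,
            (2 <= n)%N ->
              (circuit_size C)%:R <= expR (c * (n%:R `^ (1 / 3) * ln n%:R))
          & forall x, (out_sum C x = 0 %[mod 5])%N \/ (out_sum C x = 1 %[mod 5])%N].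
Proof.
exists 23 => // n f fS.
have [k2 n2 b2] := @prime_power_cube 2 n isT.
have [k3 n3 b3] := @prime_power_cube 3 n isT.
have [k5 n5 b5] := @prime_power_cube 5 n isT.
have nN : (n < 2 ^ k2 * 3 ^ k3 * 5 ^ k5)%N.
  (* After cubing, each of the three factors exceeds [n]. *)
  by rewrite -(@ltn_exp2r _ _ 3) // !expnMn ![in X in (X < _)%N]expnS expn0 muln1 mulnA
     ltn_mul // ltn_mul.
pose d := maxn (2 ^ k2) (maxn (3 ^ k3) (5 ^ k5)).
have [||| C [CS CE]] := symmetric_circuit (d := d) fS _ _ _ nN.
- exact: leq_maxl.
- by rewrite /d !leq_max leqnn orbT.
- by rewrite /d !leq_max leqnn !orbT.
have CEn x : (out_sum C x = ~~ f x %[mod 5])%N.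
  by have /(congr1 val) := CE x; rewrite /= !val_Zp_nat.
exists C; split.
- by move=> x; rewrite /circuit_val /mod_gate /dvdn -/(out_sum C x) CEn; case: (f x).
- move=> n_ge2; rewrite CS; apply: size_bound => //.
  have n_gt0 : (0 < n)%N by apply: ltnW.
  move: (b2 n_gt0) (b3 n_gt0) (b5 n_gt0); rewrite /d.
  by case: (leqP (3 ^ k3) (5 ^ k5)) => _; case: leqP => _; lia.
- by move=> x; rewrite CEn; case: (f x); [left | right].
Qed.
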